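(* Let $\alpha,\beta,\gamma$ be positive integers and $r$ a positive integer. There is a constant $c_{r,\alpha,\beta,\gamma}>0$, depending only on $r,\alpha,\beta,\gamma$, such that for every prime $p$ and every $r$-colouring $c:\mathbb{F}_p\to\{1,\dots,r\}$ there are at least $c_{r,\alpha,\beta,\gamma}p^2$ triples $(x,y,z)\in\mathbb{F}_p^3$ with $x^\alpha+y^\beta=z^\gamma$ and $c(x)=c(y)=c(z)$.
   Context: $p$ denotes a prime and $\mathbb{F}_p=\mathbb{Z}/p\mathbb{Z}$. The constant does not depend on $p$. *)

(* Defs.v *)
From mathcomp Require Import all_boot all_order all_algebra.
From mathcomp Require Import reals.

Set Implicit Arguments.
Unset Strict Implicit.
Unset Printing Implicit Defensive.

Import Order.TTheory GRing.Theory Num.Theory.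

Local Open Scope ring_scope.

Definition mono_solutions (a b g r p : nat) (c : 'F_p -> 'I_r) :
    {set 'F_p * 'F_p * 'F_p} :=
  [set t | let: (x, y, z) := t in
           [&& x ^+ a + y ^+ b == z ^+ g, c x == c y & c y == c z]].

(* Main.v *)
Require Import Defs.
From mathcomp Require Import all_boot all_order all_algebra.
From mathcomp Require Import reals.
From mathcomp.real_closed Require Import complex.
From mathcomp Require Import ring lra.

Set Implicit Arguments.
Unset Strict Implicit.
Unset Printing Implicit Defensive.

Import Order.TTheory GRing.Theory Num.Theory ComplexField.Normc.

Local Open Scope ring_scope.
Local Open Scope complex_scope.

(** To a set A of positive density attach the autocorrelation mu_A of its
    normalised indicator, supported on A - A, and the weight
    w_A(x) = prod_(k <= K) mu_A(x^k).  Call a colour dense on A if it carries a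
    fixed proportion (depending on r only) of w_A.

    Given finitely many sets A, a pigeonhole over scales of the large spectra of
    the pushforwards of 1_C w_A under the b-th and g-th powers (C a colour
    class) produces a set A' inside a cell of the partition by large
    frequencies.  On A' - A' the large frequencies are trivial, the intermediate
    ones carry little energy and the remaining ones are uniformly tiny.  Hence
    the count of z^g - y^b = x^a with y, z in C weighted by w_A and x in C
    weighted by w_A' factorises: it is about the mass of C for w_A' times the
    overlap of the densities of y^b and z^g smoothed at scale A'.
    By Weyl's bound x, x^2, ..., x^K are jointly equidistributed, and this
    forces, for each A, a large overlap for some colour dense on A.  If this
    colour is also dense on A', we have found c p^2 solutions.  Otherwise A and
    A' have different sets of dense colours, which can happen only for 2^r sets
    in a row. *)

(** * Averages over a finite field *)

Section Average.
Variables (F : finFieldType) (K : numFieldType).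
Implicit Types f g : F -> K.

Definition avg f : K := (\sum_x f x) / #|F|%:R.

Lemma card_neq0 : #|F|%:R != 0 :> K.
Proof. by rewrite pnatr_eq0 -lt0n; apply/card_gt0P; exists 0. Qed.

Lemma card_gt0R : 0 < #|F|%:R :> K.
Proof. by rewrite ltr0n; apply/card_gt0P; exists 0. Qed.

Lemma eq_avg f g : f =1 g -> avg f = avg g.
Proof. by move=> fg; rewrite /avg (eq_bigr _ (fun x _ => fg x)). Qed.

Lemma avg_cst (k : K) : avg (fun=> k) = k.
Proof. by rewrite /avg sumr_const -(mulr_natr k) mulfK ?card_neq0. Qed.

Lemma avgD f g : avg (fun x => f x + g x) = avg f + avg g.
Proof. by rewrite /avg big_split mulrDl. Qed.

Lemma avgB f g : avg (fun x => f x - g x) = avg f - avg g.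
Proof. by rewrite /avg sumrB mulrBl. Qed.

Lemma avgZ (k : K) f : avg (fun x => k * f x) = k * avg f.
Proof. by rewrite /avg -mulr_sumr mulrA. Qed.

Lemma avgZr (k : K) f : avg (fun x => f x * k) = avg f * k.
Proof. by rewrite /avg -mulr_suml mulrAC. Qed.

Lemma exchange_avg (f : F -> F -> K) :
  avg (fun x => avg (f x)) = avg (fun y => avg (f^~ y)).
Proof. by rewrite /avg -!mulr_suml exchange_big. Qed.

Lemma avg_sum (I : finType) (P : pred I) (f : I -> F -> K) :
  avg (fun x => \sum_(i | P i) f i x) = \sum_(i | P i) avg (f i).
Proof. by rewrite /avg exchange_big mulr_suml. Qed.

Lemma avg_shift (a : F) f : avg (fun x => f (x + a)) = avg f.
Proof.
rewrite /avg; congr (_ / _); symmetry.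
exact: (reindex_inj (addIr a)).
Qed.

Lemma avg_mulr f g : avg f * avg g = avg (fun x => avg (fun y => f x * g y)).
Proof. by rewrite -avgZr; apply: eq_avg => x; rewrite avgZ. Qed.

Lemma ler_avg f g : (forall x, f x <= g x) -> avg f <= avg g.
Proof.
move=> fg; rewrite /avg ler_pM2r ?invr_gt0 ?card_gt0R //.
by apply: ler_sum.
Qed.

Lemma avg_ge0 f : (forall x, 0 <= f x) -> 0 <= avg f.
Proof. by move=> f0; rewrite -(avg_cst 0); apply: ler_avg. Qed.

End Average.

(** The variance of [f] under the probability weight [m] is nonnegative. *)
Lemma avg_sqr (R : realFieldType) (F : finFieldType) (m f : F -> R) :
  (forall x, 0 <= m x) -> avg m = 1 ->
  avg (fun x => m x * f x) ^+ 2 <= avg (fun x => m x * f x ^+ 2).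
Proof.
move=> m0 m1; set k := avg (fun x => m x * f x).
have : 0 <= avg (fun x => m x * (f x - k) ^+ 2).
  by apply: avg_ge0 => x; rewrite mulr_ge0 ?sqr_ge0.
rewrite (eq_avg (g := fun x => m x * f x ^+ 2 - 2 * k * (m x * f x) + k ^+ 2 * m x)).
  by rewrite avgD avgB !avgZ m1 -/k; lra.
by move=> x; ring.
Qed.

(** * The real-valued modulus of complex numbers *)

Section ComplexNorm.
Variable R : realType.
Implicit Types z : R[i].

Lemma norm_normc z : `|z| = (normc z)%:C.
Proof. by case: z => a b. Qed.

Lemma normc_ge0 z : 0 <= normc z.
Proof. by rewrite -lecR -norm_normc normr_ge0. Qed.

Lemma normcD z z' : normc (z + z') <= normc z + normc z'.
Proof. by rewrite -lecR rmorphD /= -!norm_normc ler_normD. Qed.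

Lemma normc_opp z : normc (- z) = normc z.
Proof. by apply: complexI; rewrite -!norm_normc normrN. Qed.

Lemma normc_sum (I : finType) (P : pred I) (f : I -> R[i]) :
  normc (\sum_(i | P i) f i) <= \sum_(i | P i) normc (f i).
Proof.
elim/big_rec2: _ => [|i x y _ h]; first by rewrite normc0.
by apply: le_trans (normcD _ _) _; rewrite lerD2l.
Qed.

Lemma normc_real (x : R) : normc x%:C = `|x|.
Proof. by apply: complexI; rewrite -norm_normc normc_def /= expr0n addr0 sqrtr_sqr. Qed.

Lemma normc_sqr z : (normc z ^+ 2)%:C = z * conjc z.
Proof. by rewrite rmorphXn /= -norm_normc sqr_normc. Qed.

Lemma normc_conj z : normc (conjc z) = normc z.
Proof. by apply: complexI; rewrite -!norm_normc normcJ. Qed.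

Lemma normc_prod (I : finType) (f : I -> R[i]) :
  normc (\prod_i f i) = \prod_i normc (f i).
Proof. by rewrite (big_morph _ (@normcM R) (@normc1 R)). Qed.

Lemma normcBC z z' : normc (z - z') = normc (z' - z).
Proof. by rewrite -normc_opp opprB. Qed.

Lemma avg_real (F : finFieldType) (f : F -> R) :
  (avg f)%:C = avg (fun x => (f x)%:C).
Proof. by rewrite /avg fmorph_div rmorph_sum rmorph_nat. Qed.

Lemma normc_avg (F : finFieldType) (f : F -> R[i]) :
  normc (avg f) <= avg (fun x => normc (f x)).
Proof.
rewrite /avg normcM normcV.
have -> : (#|F|%:R : R[i]) = (#|F|%:R)%:C by rewrite rmorph_nat.
rewrite normc_real normr_nat.
by rewrite ler_wpM2r ?invr_ge0 ?ler0n ?normc_sum.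
Qed.

End ComplexNorm.

(** * Fourier analysis on a finite field *)

Section Fourier.
Variables (R : realType) (F : finFieldType).

(** A nontrivial unitary character of the additive group. One such [e] is enough: over a field its
    dilates [x |-> e (xi * x)] are all the characters. *)
Definition add_char (e : F -> R[i]) :=
  [/\ {morph e : x y / x + y >-> x * y}, forall x, normc (e x) = 1 &
      exists x, e x != 1].

Variable e : F -> R[i].
Hypothesis e_char : add_char e.
Local Notation q := (#|F|%:R).

Lemma charD x y : e (x + y) = e x * e y. Proof. by case: e_char. Qed.
Lemma char_norm x : normc (e x) = 1. Proof. by case: e_char. Qed.

Lemma char_neq0 x : e x != 0.
Proof. by apply/eqP => ex0; move: (char_norm x) (oner_neq0 R); rewrite ex0 normc0 => <- /eqP. Qed.

Lemma char0 : e 0 = 1.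
Proof. by apply: (mulIf (char_neq0 0)); rewrite -charD addr0 mul1r. Qed.

Lemma charN x : e (- x) = conjc (e x).
Proof.
apply: (mulfI (char_neq0 x)); rewrite -charD subrr char0 -normc_sqr char_norm.
by rewrite expr1n.
Qed.

Lemma charB x y : e (x - y) = e x * conjc (e y).
Proof. by rewrite charD charN. Qed.

Lemma char_prod (I : finType) (f : I -> F) :
  e (\sum_i f i) = \prod_i e (f i).
Proof. by rewrite (big_morph _ charD char0). Qed.

Lemma char_dist x y : normc (e (x - y) - 1) = normc (e x - e y).
Proof.
rewrite -[RHS](mulr1) -(char_norm (- y)) -normcM mulrBl -!charD subrr.
by rewrite char0.
Qed.

Lemma sum_char (t : F) : \sum_x e (x * t) = q * (t == 0)%:R.
Proof.
have [->|t0] := eqVneq t 0.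
  under eq_bigr do rewrite mulr0 char0.
  by rewrite sumr_const mulr1.
(* Translating [x] by [x0 / t] multiplies the sum by [e x0], which is not 1. *)
rewrite mulr0; have [x0 ex0] : exists x, e x != 1 by case: e_char.
have h : \sum_x e (x * t) = \sum_x e ((x + x0 / t) * t).
  exact: (reindex_inj (addIr (x0 / t))).
have {h}: \sum_x e (x * t) * (1 - e x0) = 0.
  rewrite -mulr_suml mulrBr mulr1 {1}h mulr_suml -sumrB big1 // => x _.
  by rewrite mulrDl mulfVK // charD subrr.
by rewrite -mulr_suml => /eqP; rewrite mulf_eq0 subr_eq0 [1 == _]eq_sym (negPf ex0) orbF => /eqP.
Qed.

Lemma avg_char (t : F) : avg (fun x => e (x * t)) = (t == 0)%:R.
Proof. by rewrite /avg sum_char mulrAC mulfV ?mul1r ?card_neq0. Qed.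

(* The Fourier transform of the pushforward of a under u. *)
Definition fourier (a : F -> R) (u : F -> F) (xi : F) : R[i] :=
  avg (fun x => (a x)%:C * e (xi * u x)).

Lemma fourier0 a u : fourier a u 0 = (avg a)%:C.
Proof. by rewrite avg_real; apply: eq_avg => x; rewrite mul0r char0 mulr1. Qed.

Lemma fourierN a u xi : fourier a u (- xi) = conjc (fourier a u xi).
Proof.
rewrite /fourier /avg fmorph_div rmorph_sum rmorph_nat.
congr (_ / _); apply: eq_bigr => x _.
by rewrite mulNr charN [RHS]rmorphM; congr (_ * _); rewrite [RHS]conjc_real.
Qed.

Lemma normc_fourier a u xi :
  (forall x, 0 <= a x) -> normc (fourier a u xi) <= avg a.
Proof.
move=> a0; apply: le_trans (normc_avg _) _; apply: ler_avg => x.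
by rewrite normcM char_norm mulr1 normc_real ger0_norm.
Qed.

(** Two variables stay free once the equation is imposed; dividing by [q ^+ 2] makes the weighted
    count independent of the size of the field. *)
Definition trilin (a : F -> R) (u : F -> F) (b : F -> R) (v : F -> F)
    (w : F -> R) (h : F -> F) : R :=
  (\sum_x \sum_y \sum_z (u x + v y + h z == 0)%:R * (a x * b y * w z)) / q ^+ 2.

Lemma trilin_fourier a u b v w h :
  (trilin a u b v w h)%:C =
  \sum_xi fourier a u xi * fourier b v xi * fourier w h xi.
Proof.
have Hxi xi : fourier a u xi * fourier b v xi * fourier w h xi =
  (\sum_x \sum_y \sum_z e (xi * (u x + v y + h z)) * (a x * b y * w z)%:C)
   / q ^+ 3.
  rewrite /fourier /avg.
  rewrite [in X in X * _]mulrACA -invfM mulrACA -invfM -expr2 -exprSr.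
  congr (_ / _).
  rewrite mulr_suml mulr_suml; apply: eq_bigr => x _.
  rewrite [X in X * _]mulr_sumr mulr_suml; apply: eq_bigr => y _.
  rewrite mulr_sumr; apply: eq_bigr => z _.
  rewrite !mulrDr !charD !rmorphM /=; ring.
under [RHS]eq_bigr do rewrite Hxi.
rewrite -mulr_suml exchange_big /trilin fmorph_div rmorphXn rmorph_nat.
have q0 := card_neq0 F R[i].
have H3 (t : R[i]) : t / q ^+ 2 = t * q / q ^+ 3 by field.
rewrite H3; congr (_ / _).
rewrite rmorph_sum mulr_suml; apply: eq_bigr => x _.
rewrite [RHS]exchange_big rmorph_sum mulr_suml; apply: eq_bigr => y _.
rewrite [RHS]exchange_big rmorph_sum mulr_suml; apply: eq_bigr => z _.
rewrite -mulr_suml sum_char !rmorphM /= rmorph_nat; ring.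
Qed.

(** Pairs with [u x = u y] appear because the transform is that of the pushforward of [a], not of
    [a] itself. *)
Lemma parseval a u :
  \sum_xi normc (fourier a u xi) ^+ 2 =
  (\sum_x \sum_y (u x == u y)%:R * (a x * a y)) / q.
Proof.
have Hxi xi : fourier a u xi * conjc (fourier a u xi) =
  (\sum_x \sum_y e (xi * (u x - u y)) * (a x * a y)%:C) / q ^+ 2.
  rewrite -fourierN /fourier /avg mulrACA -invfM -expr2; congr (_ / _).
  rewrite mulr_suml; apply: eq_bigr => x _.
  rewrite mulr_sumr; apply: eq_bigr => y _.
  rewrite mulrBr charD mulNr !rmorphM /=; ring.
apply: complexI; rewrite rmorph_sum.
under eq_bigr do rewrite /= normc_sqr Hxi.
rewrite -mulr_suml exchange_big fmorph_div rmorph_nat.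
have q0 := card_neq0 F R[i].
have H2 (t : R[i]) : t / q = t * q / q ^+ 2 by field.
rewrite H2; congr (_ / _).
rewrite rmorph_sum mulr_suml; apply: eq_bigr => x _.
rewrite [LHS]exchange_big rmorph_sum mulr_suml; apply: eq_bigr => y _.
rewrite -mulr_suml sum_char !rmorphM /= rmorph_nat subr_eq0; ring.
Qed.

Lemma parseval_le a u (k : nat) (A : R) :
  (forall x, 0 <= a x <= A) -> (forall t, (#|[set x | u x == t]| <= k)%N) ->
  \sum_xi normc (fourier a u xi) ^+ 2 <= k%:R * A ^+ 2.
Proof.
move=> aA uk; rewrite parseval ler_pdivrMr ?card_gt0R //.
have -> : k%:R * A ^+ 2 * q = \sum_(x : F) k%:R * A ^+ 2.
  by rewrite sumr_const mulr_natr.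
apply: ler_sum => x _.
have -> : \sum_y (u x == u y)%:R * (a x * a y) = \sum_(y in [set y | u y == u x]) a x * a y.
  rewrite [RHS]big_mkcond; apply: eq_bigr => y _; rewrite inE eq_sym.
  by case: eqP; rewrite ?mul1r ?mul0r.
apply: le_trans (_ : \sum_(y in [set y | u y == u x]) A ^+ 2 <= _).
  apply: ler_sum => y _; case/andP: (aA x) => ? ?; case/andP: (aA y) => ? ?.
  by rewrite expr2 ler_pM.
rewrite sumr_const -(mulr_natl (A ^+ 2)) ler_wpM2r ?sqr_ge0 ?ler_nat //.
Qed.

Lemma fourier_inversion a x :
  (a x)%:C = \sum_xi fourier a id xi * e (xi * - x).
Proof.
have Hxi xi : fourier a id xi * e (xi * - x) =
  (\sum_y e (xi * (y - x)) * (a y)%:C) / q.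
  rewrite /fourier /avg mulrAC; congr (_ / _); rewrite mulr_suml.
  by apply: eq_bigr => y _ /=; rewrite mulrDr charD [RHS]mulrC mulrA.
under eq_bigr do rewrite Hxi.
rewrite -mulr_suml exchange_big (bigD1 x) //= [X in _ + X]big1 ?addr0.
  rewrite -mulr_suml sum_char subrr eqxx mulr1 mulrAC mulfV ?mul1r //.
  exact: card_neq0.
by move=> y yx; rewrite -mulr_suml sum_char subr_eq0 (negPf yx) mulr0 mul0r.
Qed.

End Fourier.

(** * Comparing two trilinear counts that share their large frequencies *)

Section Comparison.
Variables (R : realType) (F : finFieldType) (e : F -> R[i]).
Hypothesis e_char : add_char e.
Local Notation q := (#|F|%:R).
Local Notation fhat := (fourier e).

(** On [L] the phase of [h] is nearly 1 wherever [w] lives, so the transform of [w] is close to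
    [avg w]. On [S :\: L] it is at most [avg w] and the other two factors have little energy. Off
    [S] the transform of [a] is at most [eps], and the other two are controlled by their
    energies. *)
Lemma trilin_structured (a : F -> R) u b v (w : F -> R) h (L S : {set F})
    (B Bw rho eta eps : R) :
  (forall x, 0 <= w x) ->
  (forall x xi, xi \in L -> w x != 0 -> normc (e (xi * h x) - 1) <= rho) ->
  \sum_xi normc (fhat a u xi) ^+ 2 <= B ->
  \sum_xi normc (fhat b v xi) ^+ 2 <= B ->
  \sum_xi normc (fhat w h xi) ^+ 2 <= Bw ->
  \sum_(xi in S :\: L)
    (normc (fhat a u xi) ^+ 2 + normc (fhat b v xi) ^+ 2) <= eta ->
  (forall xi, xi \notin S -> normc (fhat a u xi) <= eps) ->
  0 <= rho -> 0 <= eps ->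
  normc ((trilin a u b v w h)%:C
         - (avg w)%:C * \sum_(xi in L) fhat a u xi * fhat b v xi)
    <= avg w * (rho * B + eta) + eps * (B + Bw).
Proof.
move=> w0 wL aB bB wB mid far rho0 eps0.
have W0 := avg_ge0 w0; set W := avg w in W0 *.
rewrite (trilin_fourier e_char) mulr_sumr [in X in _ - X]big_mkcond -sumrB.
apply: le_trans (normc_sum _ _) _.
set A := fun xi => normc (fhat a u xi) ^+ 2.
set A' := fun xi => normc (fhat b v xi) ^+ 2.
set A'' := fun xi => normc (fhat w h xi) ^+ 2.
(* One summand per frequency range; products are split by 2ab <= a^2 + b^2, and the first and last
   summands, being nonnegative, are extended to all frequencies. *)
apply: le_trans (_ : \sum_xi (W * rho / 2 * (A xi + A' xi)
   + (if xi \in S :\: L then W / 2 * (A xi + A' xi) else 0)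
   + eps / 2 * (A' xi + A'' xi)) <= _); last first.
  rewrite !big_split /= -big_mkcond -!mulr_sumr !big_split /=.
  have h1 := ler_wpM2l (divr_ge0 (mulr_ge0 W0 rho0) (ler0n R 2)) (lerD aB bB).
  have h2 := ler_wpM2l (divr_ge0 eps0 (ler0n R 2)) (lerD bB wB).
  have h3 : W / 2 * (\sum_(xi in S :\: L) A xi + \sum_(xi in S :\: L) A' xi)
     <= W / 2 * eta.
    by rewrite -big_split /= ler_wpM2l // divr_ge0.
  have : 0 <= W / 2 * eta.
    apply: le_trans h3; rewrite mulr_ge0 ?divr_ge0 ?addr_ge0 ?sumr_ge0 // => *;
      exact: sqr_ge0.
  have : 0 <= eps * (B + Bw).
    rewrite mulr_ge0 // addr_ge0 //.
      by apply: le_trans bB; apply: sumr_ge0 => *; exact: sqr_ge0.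
    by apply: le_trans wB; apply: sumr_ge0 => *; exact: sqr_ge0.
  lra.
apply: ler_sum => xi _.
have AA : normc (fhat a u xi) * normc (fhat b v xi) <= (A xi + A' xi) / 2.
  have := sqr_ge0 (normc (fhat a u xi) - normc (fhat b v xi)).
  by rewrite /A /A'; nra.
have AW : normc (fhat b v xi) * normc (fhat w h xi) <= (A' xi + A'' xi) / 2.
  have := sqr_ge0 (normc (fhat b v xi) - normc (fhat w h xi)).
  by rewrite /A' /A''; nra.
have n0 : 0 <= normc (fhat a u xi) * normc (fhat b v xi).
  by rewrite mulr_ge0 ?normc_ge0.
have n1 : 0 <= normc (fhat b v xi) * normc (fhat w h xi).
  by rewrite mulr_ge0 ?normc_ge0.
have s1 : 0 <= W * rho / 2 * (A xi + A' xi).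
  by rewrite mulr_ge0 ?divr_ge0 ?(mulr_ge0 W0) // addr_ge0 // sqr_ge0.
have s2 : 0 <= eps / 2 * (A' xi + A'' xi).
  by rewrite mulr_ge0 ?divr_ge0 // addr_ge0 // sqr_ge0.
rewrite inE; case: ifPn => [xiL | xiL].
  rewrite mulrC -mulrBl mulrC normcM normcM.
  apply: (@le_trans _ _ ((A xi + A' xi) / 2 * (W * rho))); last first.
    rewrite /=; lra.
  apply: ler_pM => //; first exact: normc_ge0.
  rewrite /fourier avg_real -avgB.
  apply: le_trans (normc_avg _) _.
  rewrite -avgZr; apply: ler_avg => x.
  rewrite -[X in _ - X]mulr1 -mulrBr normcM normc_real ger0_norm //.
  have [->|wx] := eqVneq (w x) 0; first by rewrite !mul0r.
  by rewrite ler_wpM2l // wL.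
rewrite subr0 /=; case: ifPn => [xiS | xiS].
  rewrite normcM normcM.
  have := ler_pM n0 (normc_ge0 _) AA (normc_fourier e_char h xi w0).
  rewrite -/W; lra.
rewrite -mulrA normcM [X in _ * X]normcM.
have := ler_pM (normc_ge0 _) n1 (far _ xiS) AW.
lra.
Qed.

(** Both weights, [w] along [h] and the probability density [m] along the identity, produce the same
    sum over [L], which is eliminated. *)
Lemma trilin_compare (a : F -> R) u b v (w m : F -> R) h (L S : {set F})
    (B Bw rho eta eps : R) :
  (forall x, 0 <= w x) ->
  (forall x xi, xi \in L -> w x != 0 -> normc (e (xi * h x) - 1) <= rho) ->
  (forall x, 0 <= m x) -> avg m = 1 ->
  (forall x xi, xi \in L -> m x != 0 -> normc (e (xi * x) - 1) <= rho) ->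
  \sum_xi normc (fhat a u xi) ^+ 2 <= B ->
  \sum_xi normc (fhat b v xi) ^+ 2 <= B ->
  \sum_xi normc (fhat w h xi) ^+ 2 <= Bw ->
  \sum_xi normc (fhat m id xi) ^+ 2 <= Bw ->
  \sum_(xi in S :\: L)
    (normc (fhat a u xi) ^+ 2 + normc (fhat b v xi) ^+ 2) <= eta ->
  (forall xi, xi \notin S -> normc (fhat a u xi) <= eps) ->
  0 <= rho -> 0 <= eps ->
  avg w * (trilin a u b v m id - 2 * (rho * B + eta) - eps * (B + Bw))
    - eps * (B + Bw) <= trilin a u b v w h.
Proof.
move=> w0 wL m0 m1 mL aB bB wB mB mid far rho0 eps0.
have h1 := trilin_structured w0 wL aB bB wB mid far rho0 eps0.
have := trilin_structured m0 mL aB bB mB mid far rho0 eps0.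
rewrite m1 mul1r mul1r; set k := \sum_(xi in L) _ in h1 * => h2.
have W0 := avg_ge0 w0.
have : normc ((avg w)%:C * (trilin a u b v m id)%:C - (trilin a u b v w h)%:C)
  <= avg w * (rho * B + eta + eps * (B + Bw))
     + (avg w * (rho * B + eta) + eps * (B + Bw)).
  rewrite -(subrKA ((avg w)%:C * k)) -mulrBr.
  apply: le_trans (normcD _ _) _; apply: lerD; last by rewrite normcBC.
  by rewrite normcM normc_real ger0_norm // ler_wpM2l.
rewrite -rmorphM -rmorphB normc_real => /(le_trans (ler_norm _)).
nra.
Qed.

End Comparison.

(** * The Wiener norm and joint equidistribution of powers *)

Section WienerNorm.
Variables (R : realType) (F : finFieldType) (e : F -> R[i]).
Hypothesis e_char : add_char e.
Local Notation fhat := (fourier e).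

Definition wiener (f : F -> R) : R := \sum_xi normc (fhat f id xi).

Lemma wiener_ge0 f : 0 <= wiener f.
Proof. by apply: sumr_ge0 => *; exact: normc_ge0. Qed.

Lemma fourierM f g xi :
  fhat (fun x => f x * g x) id xi =
  \sum_zeta fhat f id zeta * fhat g id (xi - zeta).
Proof.
rewrite {1}/fourier.
under eq_avg => x do rewrite rmorphM /= (fourier_inversion e_char f) -mulrA mulr_suml.
rewrite avg_sum; apply: eq_bigr => zeta _.
rewrite -avgZ; apply: eq_avg => x /=.
rewrite mulrBl (charD e_char) mulrN; ring.
Qed.

(** The coefficients of a product are a convolution, and convolution is submultiplicative in l^1. *)
Lemma wienerM f g : wiener (fun x => f x * g x) <= wiener f * wiener g.
Proof.
rewrite /wiener; under eq_bigr do rewrite fourierM.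
apply: le_trans (ler_sum _ (fun xi _ => normc_sum _ _)) _.
rewrite exchange_big mulr_suml; apply: ler_sum => zeta _.
rewrite (reindex_inj (addIr zeta)) mulr_sumr; apply: ler_sum => xi _ /=.
by rewrite addrK normcM.
Qed.

Lemma wiener1 : wiener (fun=> 1) = 1.
Proof.
have f1 xi : fhat (fun=> 1) id xi = (xi == 0)%:R.
  rewrite -(avg_char e_char); apply: eq_avg => x /=.
  by rewrite mul1r mulrC.
rewrite /wiener (bigD1 0) //= f1 eqxx normc1 big1 ?addr0 // => xi xi0.
by rewrite f1 (negPf xi0) normc0.
Qed.

Lemma wienerX f n : wiener (fun x => f x ^+ n) <= wiener f ^+ n.
Proof.
elim: n => [|n IH]; first by rewrite expr0 wiener1.
rewrite exprS; apply: le_trans (_ : wiener (fun x => f x * f x ^+ n) <= _).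
  by apply: ler_sum => xi _; rewrite (_ : fhat _ _ _ = fhat (fun x => f x * f x ^+ n) id xi) //;
    apply: eq_avg => x; rewrite exprS.
by apply: le_trans (wienerM _ _) _; rewrite ler_wpM2l ?wiener_ge0.
Qed.

(** Each [f k] is expanded in characters. The zero frequency tuple gives the product of the
    averages; every other tuple carries a Weyl sum of size at most [eps]. *)
Lemma equidistribution K (f : 'I_K -> F -> R) (eps : R) :
  0 <= eps ->
  (forall xi : {ffun 'I_K -> F}, xi != 0 ->
     normc (avg (fun x => e (\sum_k xi k * x ^+ k.+1))) <= eps) ->
  `|avg (fun x => \prod_k f k (x ^+ k.+1)) - \prod_k avg (f k)|
    <= eps * \prod_k wiener (f k).
Proof.
move=> eps0 weyl.
have expand : (avg (fun x => \prod_k f k (x ^+ k.+1)))%:C =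
  \sum_(xi : {ffun 'I_K -> F}) (\prod_k fhat (f k) id (xi k)) *
     avg (fun x => e (\sum_k (- xi) k * x ^+ k.+1)).
  rewrite avg_real.
  under eq_avg => x.
    rewrite rmorph_prod /=.
    under eq_bigr do rewrite (fourier_inversion e_char).
    rewrite bigA_distr_bigA /=.
    under eq_bigr do rewrite big_split /=.
    over.
  rewrite avg_sum; apply: eq_bigr => xi _; rewrite -avgZ; apply: eq_avg => x.
  rewrite (char_prod e_char); congr (_ * _); apply: eq_bigr => k _.
  by rewrite ffunE mulrN mulNr.
rewrite -normc_real rmorphB [X in X - _]expand (bigD1 (0 : {ffun _ -> _})) //=.
rewrite [X in X + _ - _](_ : _ = (\prod_k avg (f k))%:C); last first.
  rewrite rmorph_prod -[RHS]mulr1; congr (_ * _).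
    by apply: eq_bigr => k _; rewrite ffunE (fourier0 e_char).
  rewrite -[RHS](avg_cst F); apply: eq_avg => x.
  by rewrite oppr0 big1 ?(char0 e_char) // => k _; rewrite ffunE mul0r.
rewrite addrAC subrr add0r.
apply: le_trans (normc_sum _ _) _.
rewrite /wiener bigA_distr_bigA /= mulr_sumr.
rewrite [leRHS](bigD1 (0 : {ffun _ -> _})) //=; apply: ler_wpDl.
  by rewrite mulr_ge0 ?prodr_ge0 // => *; exact: normc_ge0.
apply: ler_sum => xi xi0; rewrite normcM normc_prod mulrC ler_wpM2r //.
  by apply: prodr_ge0 => *; exact: normc_ge0.
by apply: weyl; rewrite oppr_eq0.
Qed.

End WienerNorm.

(** * The autocorrelation of a dense set *)

Section Kernel.
Variables (R : realType) (F : finFieldType) (e : F -> R[i]).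
Hypothesis e_char : add_char e.
Local Notation q := (#|F|%:R).
Local Notation fhat := (fourier e).
Variables (A : {set F}) (M : R).

Definition dens (t : F) : R := (t \in A)%:R * (q / #|A|%:R).
(** The function mu_A of the overview. Its Fourier coefficients are the squared moduli of those of
    [dens], hence summable by Parseval. *)
Definition ker (s : F) : R := avg (fun t => dens t * dens (t + s)).

Lemma dens_ge0 t : 0 <= dens t.
Proof. by rewrite mulr_ge0 ?divr_ge0. Qed.

Lemma ker_ge0 t : 0 <= ker t.
Proof. by apply: avg_ge0 => s; rewrite mulr_ge0 ?dens_ge0. Qed.

Hypothesis AM : q <= M * #|A|%:R.

Lemma dense_card : 0 < #|A|%:R :> R.
Proof.
rewrite lt_neqAle ler0n andbT; apply/eqP => A0; move: AM (card_gt0R F R).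
by rewrite -A0 mulr0 => h1 /lt_le_trans /(_ h1); rewrite ltxx.
Qed.

Lemma dens_le t : dens t <= M.
Proof.
have h : q / #|A|%:R <= M by rewrite ler_pdivrMr ?dense_card.
rewrite /dens; case: (_ \in _); rewrite ?mul1r // mul0r.
by apply: le_trans h; rewrite divr_ge0.
Qed.

Lemma avg_dens : avg dens = 1.
Proof.
rewrite /avg -mulr_suml.
have -> : \sum_x (x \in A)%:R = #|A|%:R :> R.
  rewrite -sum1_card natr_sum [RHS]big_mkcond /=.
  by apply: eq_bigr => x _; case: ifP.
have := dense_card; have := card_gt0R F R; move=> /lt0r_neq0 h1 /lt0r_neq0 h2.
by field; rewrite h1 h2.
Qed.

Lemma dense_ge1 : 1 <= M.
Proof. by rewrite -avg_dens -[M](avg_cst F); apply: ler_avg => x; apply: dens_le. Qed.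

Lemma ker_le t : ker t <= M.
Proof.
have -> : M = avg (fun t => dens t * M) by rewrite avgZr avg_dens mul1r.
by apply: ler_avg => s; rewrite ler_wpM2l ?dens_ge0 ?dens_le.
Qed.

Lemma avg_ker : avg ker = 1.
Proof.
rewrite /ker exchange_avg -avg_dens; apply: eq_avg => x.
rewrite avgZ -[RHS]mulr1; congr (_ * _).
rewrite -avg_dens -[RHS](avg_shift x); apply: eq_avg => y.
by rewrite addrC.
Qed.

Lemma ker_supp s : ker s != 0 -> exists x y, [/\ x \in A, y \in A & s = y - x].
Proof.
move=> ks; have [x /andP[xA yA]|no] := pickP (fun x => (x \in A) && (x + s \in A)).
  by exists x, (x + s); split => //; rewrite addrAC subrr add0r.
case/eqP: ks; rewrite /ker -(avg_cst F 0); apply: eq_avg => x.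
by rewrite /dens; have := no x; case: (x \in A) => /= [->|_]; rewrite !mul0r ?mulr0.
Qed.

Lemma sum_dens2 : \sum_xi normc (fhat dens id xi) ^+ 2 <= M.
Proof.
rewrite (parseval e_char).
have -> : M = (\sum_x dens x * M) / q by rewrite -[RHS]/(avg _) avgZr avg_dens mul1r.
rewrite ler_wpM2r ?invr_ge0 //; apply: ler_sum => x _.
rewrite (bigD1 x) //= eqxx mul1r big1 ?addr0; last first.
  by move=> y yx; rewrite eq_sym (negPf yx) mul0r.
by rewrite ler_wpM2l ?dens_ge0 ?dens_le.
Qed.

Lemma fourier_corr f g xi :
  fhat (fun s => avg (fun t => f t * g (t + s))) id xi =
  fhat f id (- xi) * fhat g id xi.
Proof.
rewrite {1}/fourier.
under eq_avg do rewrite avg_real -avgZr.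
rewrite exchange_avg /fourier -[RHS]avgZr; apply: eq_avg => t /=.
rewrite -avgZ -[RHS](avg_shift t); apply: eq_avg => s.
rewrite rmorphM /= [t + s]addrC mulNr.
rewrite mulrACA -(charD e_char) mulrDr; congr (_ * e _).
by rewrite addrCA addNr addr0.
Qed.

(** Coefficients of a correlation are products of coefficients, so square summability of both
    factors gives summability. *)
Lemma wiener_corr f g B1 B2 :
  \sum_xi normc (fhat f id xi) ^+ 2 <= B1 ->
  \sum_xi normc (fhat g id xi) ^+ 2 <= B2 ->
  wiener e (fun s => avg (fun t => f t * g (t + s))) <= (B1 + B2) / 2.
Proof.
move=> h1 h2; apply: le_trans (_ : (\sum_xi normc (fhat f id xi) ^+ 2 +
  \sum_xi normc (fhat g id xi) ^+ 2) / 2 <= _); last by lra.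
rewrite -big_split mulr_suml; apply: ler_sum => xi _ /=.
rewrite fourier_corr normcM (fourierN e_char) normc_conj.
by have := sqr_ge0 (normc (fhat f id xi) - normc (fhat g id xi)); nra.
Qed.

Lemma wiener_ker : wiener e ker <= M.
Proof. by apply: le_trans (wiener_corr sum_dens2 sum_dens2) _; lra. Qed.

End Kernel.

(** * Weyl sums *)

Section WeylSums.
Variable R : realType.

Lemma coef_shiftX (S : comNzRingType) (h : S) i k :
  (('X + h%:P) ^+ i)`_k = h ^+ (i - k) *+ 'C(i, k).
Proof.
rewrite addrC exprDn coef_sum.
have [ki|ik] := leqP k i; last first.
  rewrite bin_small // mulr0n big1 // => j _.
  rewrite coefMn -polyC_exp coefCM coefXn.
  have -> : (k == j) = false by apply/eqP => kj; have := ltn_ord j; rewrite -kj ltnS leqNgt ik.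
  by rewrite mulr0 mul0rn.
rewrite (bigD1 (inord k : 'I_i.+1)) //= big1 ?addr0 => [|j jk].
  by rewrite coefMn -polyC_exp coefCM coefXn inordK // eqxx mulr1.
rewrite coefMn -polyC_exp coefCM coefXn.
have -> : (k == j) = false.
  by apply/eqP => kj; case/eqP: jk; apply: val_inj; rewrite /= inordK.
by rewrite mulr0 mul0rn.
Qed.

(** The leading terms cancel, and the coefficient of degree [d] is [d.+1 * h] times the leading
    coefficient of [Q]. *)
Lemma size_poly_diff (S : idomainType) (Q : {poly S}) d (h : S) :
  size Q = d.+2 -> h != 0 -> d.+1%:R != 0 :> S ->
  size (Q \Po ('X + h%:P) - Q) = d.+1.
Proof.
move=> sQ h0 d0.
have co k : (Q \Po ('X + h%:P) - Q)`_k =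
    \sum_(i < d.+2) Q`_i * (h ^+ (i - k) *+ 'C(i, k) - (k == i)%:R).
  rewrite coefB coef_comp_poly sQ.
  rewrite -[in X in _ - X](coefK Q) sQ poly_def coef_sum -sumrB.
  by apply: eq_bigr => i _; rewrite coef_shiftX coefZ coefXn mulrBr.
have z i k : (i <= k)%N -> h ^+ (i - k) *+ 'C(i, k) - (k == i)%:R = 0.
  rewrite leq_eqVlt => /orP[/eqP ->|ik]; first by rewrite subnn binn eqxx subrr.
  by rewrite bin_small // mulr0n gtn_eqF // subrr.
apply/eqP; rewrite eqn_leq; apply/andP; split.
  apply/leq_sizeP => k dk; rewrite co big1 // => i _.
  by rewrite z ?mulr0 // (leq_trans _ dk) // -ltnS.
rewrite ltnNge; apply/negP => /leq_sizeP /(_ d (leqnn d)) /eqP.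
rewrite co big_ord_recr /= big1 ?add0r => [|i _]; last first.
  by rewrite z ?mulr0 // -ltnS.
rewrite subSnn binSn ltn_eqF // subr0 expr1 -mulr_natr !mulf_eq0.
rewrite (negPf h0) (negPf d0) !orbF => /eqP Qd.
by have := lead_coef_eq0 Q; rewrite lead_coefE sQ /= Qd eqxx -size_poly_eq0 sQ.
Qed.

Lemma avg_char_lin (F : finFieldType) (e : F -> R[i]) (Q : {poly F}) :
  add_char e -> size Q = 2 -> avg (fun x => e Q.[x]) = 0.
Proof.
move=> eC sQ; rewrite (eq_avg (g := fun x => e Q`_0 * e (x * Q`_1))).
  rewrite avgZ (avg_char eC).
  by have := lead_coef_eq0 Q; rewrite lead_coefE sQ -size_poly_eq0 sQ /= => ->; rewrite mulr0.
move=> x; rewrite -(charD eC) horner_coef sQ big_ord_recl big_ord1 /=.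
by rewrite expr0 mulr1 expr1 mulrC.
Qed.

(* Weyl differencing: the square of the sum is the average over h of the sums
   with phase Q(x + h) - Q(x), whose degree is one less when h <> 0. *)
Lemma weyl_sum d (eps : R) : 0 < eps ->
  exists N : nat, forall (F : finFieldType) (e : F -> R[i]) (Q : {poly F}),
    add_char e -> (forall n, (0 < n <= d.+1)%N -> n%:R != 0 :> F) ->
    (N <= #|F|)%N -> size Q = d.+2 -> normc (avg (fun x => e Q.[x])) <= eps.
Proof.
elim: d eps => [|d IH] eps eps0.
  exists 0%N => F e Q eC _ _ sQ; rewrite avg_char_lin // normc0; exact: ltW.
have eps2 : 0 < eps ^+ 2 / 2 by rewrite divr_gt0 ?exprn_gt0.
have [N HN] := IH _ eps2.
(* The second bound on the field makes the contribution 1 / #|F| of [h = 0] at most half of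
   [eps ^+ 2]. *)
exists (maxn N (Num.truncn (eps ^+ 2 / 2)^-1).+1) => F e Q eC chF.
rewrite geq_max => /andP[NF eF] sQ.
rewrite -(ler_pXn2r (isT : (0 < 2)%N)) ?nnegrE ?normc_ge0 ?(ltW eps0) //.
set S := avg _.
have -> : normc S ^+ 2 = normc (avg (fun h => avg (fun x => e ((Q \Po ('X + h%:P) - Q).[x])))).
  have cS : conjc S = avg (fun x => conjc (e Q.[x])).
    by rewrite /S /avg fmorph_div rmorph_sum rmorph_nat.
  have n2 : 0 <= normc S ^+ 2 by rewrite sqr_ge0.
  rewrite -[LHS]ger0_norm // -normc_real normc_sqr mulrC cS -avgZr [in RHS]exchange_avg.
  congr normc; apply: eq_avg => x; rewrite /S -(avg_shift x) -avgZ.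
  apply: eq_avg => h; rewrite hornerD hornerN horner_comp hornerD hornerX hornerC.
  by rewrite (charB eC) mulrC addrC.
apply: le_trans (normc_avg _) _.
apply: (@le_trans _ _ (avg (fun h : F => (h == 0)%:R + eps ^+ 2 / 2))).
  apply: ler_avg => h; have [->|h0] := eqVneq h 0.
    apply: le_trans (normc_avg _) _.
    rewrite -[leRHS](avg_cst F); apply: ler_avg => x.
    by rewrite (char_norm eC) lerDl ltW.
  rewrite add0r; apply: HN => //.
    by move=> n /andP[n0 nd]; apply: chF; rewrite n0 leqW.
  by apply: size_poly_diff => //; apply: chF; rewrite leqnn.
rewrite avgD avg_cst /avg (bigD1 0) //= eqxx big1 ?addr0; last by move=> h /negPf ->.
have : 1 / #|F|%:R <= eps ^+ 2 / 2.
  rewrite mul1r -[leRHS]invrK lef_pV2 ?posrE ?card_gt0R ?invr_gt0 //.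
  apply: le_trans (ltW (truncnS_gt _)) _; by rewrite ler_nat.
rewrite /=; lra.
Qed.

End WeylSums.

Lemma normcX (R : realType) (z : R[i]) n : normc (z ^+ n) = normc z ^+ n.
Proof. by elim: n => [|n IH]; rewrite ?normc1 // !exprS normcM IH. Qed.

(** A root of 1 + X + ... + X^(p-1) is a p-th root of unity other than 1, since this polynomial
    takes the value p at 1; its powers form the character. *)
Lemma exists_add_char (R : realType) p : prime p -> exists e : 'F_p -> R[i], add_char e.
Proof.
move=> pp.
pose P : {poly R[i]} := \sum_(i < p) 'X^i.
have PX : 'X^p - 1%:P = ('X - 1%:P) * P :> {poly R[i]} by rewrite polyC1 subrX1.
have p0 := prime_gt0 pp; have p1 := prime_gt1 pp.
have [z z0] : exists z, root P z.
  apply/closed_rootP/eqP => sP.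
  have : size ('X^p - 1%:P : {poly R[i]}) = p.+1 by rewrite size_XnsubC.
  have P0 : P != 0 by rewrite -size_poly_eq0 sP.
  rewrite PX mulrC size_Mmonic ?monicXsubC // size_XsubC sP /= => - [p2].
  by rewrite -p2 in p1.
have zp : z ^+ p = 1.
  have : root ('X^p - 1%:P) z by rewrite PX rootM z0 orbT.
  by rewrite rootE !hornerE subr_eq0 => /eqP.
have z1 : z != 1.
  apply/eqP => z1; move: z0; rewrite z1 rootE horner_sum.
  under eq_bigr do rewrite hornerXn expr1n.
  by rewrite sumr_const card_ord pnatr_eq0 gtn_eqF.
have nz : normc z = 1.
  apply/eqP; rewrite -(@pexpr_eq1 _ (normc z) p) ?normc_ge0 //.
  by rewrite -normcX zp normc1.
exists (fun t => z ^+ t); split.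
(* Addition in ['F_p] reduces modulo this internal modulus, which equals [p] for [p] prime. *)
- have zq : z ^+ (Zp_trunc (pdiv p)).+2 = 1 by rewrite Fp_cast.
  by move=> x y; rewrite /= (expr_mod _ zq) exprD.
- by move=> x; rewrite normcX nz expr1n.
- by exists 1; rewrite -[1]/(1%R) /= expr1.
Qed.

(** * Bohr cells and gaps in the spectrum *)

Section BohrCell.
Variable R : realType.

Lemma pigeonhole_fiber (T S : finType) (s0 : S) (f : T -> S) (A : {set T}) :
  exists s, (#|A| <= #|[set x in A | f x == s]| * #|S|)%N.
Proof.
have S0 : (0 < #|S|)%N by apply/card_gt0P; exists s0.
have [s Hs] := bigop.eq_bigmax (fun s => #|[set x in A | f x == s]|) S0.
exists s; rewrite -sum1_card (partition_big f predT) //=.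
rewrite mulnC -sum_nat_const; apply: leq_sum => t _.
rewrite -Hs; apply: leq_trans (leq_bigmax (F := fun s => #|[set x in A | f x == s]|) t).
by rewrite -sum1_card; apply: eq_leq; apply: eq_bigl => x; rewrite inE.
Qed.

(** A grid of side 1/n on the square [-1,1]^2. A coordinate equal to 1 gets index 2n, hence 2n + 1
    indices per axis, and [inord] is faithful on the unit disc. *)
Definition cell n (z : R[i]) : 'I_n.*2.+1 * 'I_n.*2.+1 :=
  (inord (Num.truncn (n%:R * (1 + complex.Re z))),
   inord (Num.truncn (n%:R * (1 + complex.Im z)))).

Lemma truncn_close n (x y : R) : (0 < n)%N -> `|x| <= 1 -> `|y| <= 1 ->
  inord (Num.truncn (n%:R * (1 + x))) = inord (Num.truncn (n%:R * (1 + y))) :> 'I_n.*2.+1 ->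
  `|x - y| <= n%:R^-1.
Proof.
move=> n0 /ler_normlP[x1 x2] /ler_normlP[y1 y2] /(congr1 val) /=.
have nR : 0 < n%:R :> R by rewrite ltr0n.
have b t : - t <= 1 -> t <= 1 -> 0 <= n%:R * (1 + t) :> R /\ (Num.truncn (n%:R * (1 + t)) < n.*2.+1)%N.
  move=> t1 t2; split; first by rewrite mulr_ge0 //; lra.
  have h : 0 <= n%:R * (1 + t) by rewrite mulr_ge0 //; lra.
  rewrite ltnS -(ler_nat R); apply: le_trans (_ : n%:R * (1 + t) <= _); first by rewrite truncn_le.
  by rewrite -muln2 natrM; rewrite ler_wpM2l //; lra.
have [bx bx'] := b _ x1 x2; have [by1 by2] := b _ y1 y2.
rewrite !inordK // => txy.
have /andP[h1 h2] := truncn_itv bx; have /andP[h3 h4] := truncn_itv by1.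
rewrite txy in h1 h2; rewrite -natr1 in h2; rewrite -natr1 in h4.
rewrite -[leRHS]mul1r ler_pdivlMr // -[n%:R]ger0_norm // -normrM.
rewrite ler_norml; apply/andP; split; nra.
Qed.

Lemma cell_close n (z z' : R[i]) : (0 < n)%N -> normc z = 1 -> normc z' = 1 ->
  cell n z = cell n z' -> normc (z - z') <= 2 / n%:R.
Proof.
move=> n0 z1 z'1 [] h1 h2.
have bRe (t : R[i]) : normc t = 1 -> `|complex.Re t| <= 1 /\ `|complex.Im t| <= 1.
  case: t => a b /= ab.
  have := congr1 (fun x => x ^+ 2) ab; rewrite sqr_sqrtr ?addr_ge0 ?sqr_ge0 // expr1n => ab2.
  by split; rewrite -(ler_pXn2r (isT : (0 < 2)%N)) ?nnegrE // expr1n real_normK ?num_real // -ab2 ?lerDl ?lerDr sqr_ge0.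
have [r1 i1] := bRe _ z1; have [r2 i2] := bRe _ z'1.
have hr := truncn_close n0 r1 r2 h1; have hi := truncn_close n0 i1 i2 h2.
have -> : z - z' = (complex.Re z - complex.Re z')%:C + 'i * (complex.Im z - complex.Im z')%:C.
  by rewrite {1}(complexE z) {1}(complexE z') !rmorphB mulrBr opprD addrACA.
apply: le_trans (normcD _ _) _; rewrite normcM !normc_real.
have -> : normc ('i : R[i]) = 1 by rewrite /= expr0n expr1n add0r sqrtr1.
by rewrite mul1r; lra.
Qed.

(** Each frequency splits the current set by the grid cell of [e (xi * x)]; the largest piece loses
    at most a factor (2n + 1)^2. Only differences are controlled, which suits a kernel supported on
    them. *)
Lemma bohr_cell (F : finFieldType) (e : F -> R[i]) n (L : seq F) :
  add_char e -> (0 < n)%N ->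
  exists2 A : {set F}, (#|F| <= #|A| * (n.*2.+1 ^ 2) ^ size L)%N &
    forall xi x y, xi \in L -> x \in A -> y \in A ->
      normc (e (xi * (y - x)) - 1) <= 2 / n%:R.
Proof.
move=> eC n0; elim: L => [|xi L [A cA HA]].
  by exists setT; rewrite ?cardsT ?muln1.
have [s Hs] := pigeonhole_fiber (cell n 0) (fun x => cell n (e (xi * x))) A.
exists [set x in A | cell n (e (xi * x)) == s].
  rewrite /= expnS mulnA; apply: leq_trans cA _; rewrite leq_mul2r.
  by move: Hs; rewrite card_prod !card_ord mulnn => ->; rewrite orbT.
move=> zeta x y; rewrite inE !inE => /orP[/eqP ->|zL] /andP[xA /eqP xs] /andP[yA /eqP ys].
  rewrite mulrBr (char_dist eC); apply: cell_close => //; rewrite ?(char_norm eC) //.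
  by rewrite xs ys.
exact: HA.
Qed.

End BohrCell.

Section SpectrumGap.
Variable R : realType.

Lemma slow_increment (m : nat -> R) (B eta : R) N :
  (forall k, 0 <= m k <= B) -> B < N%:R * eta ->
  exists2 k, (k < N)%N & m k.+1 - m k <= eta.
Proof.
move=> mB BN.
have [/existsP[k Hk]|] := boolP [exists k : 'I_N, m k.+1 - m k <= eta].
  by exists k.
rewrite negb_exists => /forallP H.
have : N%:R * eta <= m N - m 0.
  rewrite -(telescope_sumr m (leq0n N)) big_mkord mulr_natl.
  rewrite -{1}(card_ord N) -sumr_const; apply: ler_sum => k _.
  by rewrite ltW // ltNge H.
have /andP[h1 h2] := mB N; have /andP[h3 h4] := mB 0%N.
lra.
Qed.

Definition spec (I F : finType) (f : I -> F -> R) (eps : R) : {set F} :=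
  [set xi | [exists i, eps < f i xi]].

Lemma card_spec (I F : finType) (f : I -> F -> R) (eps B : R) :
  0 < eps -> \sum_xi \sum_i f i xi ^+ 2 <= B ->
  #|spec f eps|%:R <= B / eps ^+ 2.
Proof.
move=> eps0 fB; rewrite ler_pdivlMr ?exprn_gt0 //; apply: le_trans fB.
rewrite mulr_natl -sumr_const big_mkcond /=; apply: ler_sum => xi _.
have s0 (P : pred I) : 0 <= \sum_(i | P i) f i xi ^+ 2 by apply: sumr_ge0 => *; exact: sqr_ge0.
case: ifP => //; rewrite inE => /existsP[i fi].
rewrite (bigD1 i) //=; apply: ler_wpDr => //.
by rewrite ler_pXn2r ?nnegrE ?ltW // (lt_trans eps0).
Qed.

(** Along the scales 1, om 1, om (om 1), ... the energy of the large spectrum increases but stays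
    below [B], so one of the first [N > B / eta] steps adds at most [eta]. The smallest scale [eps0]
    is fixed before the field and the family, which keeps later bounds uniform. *)
Lemma spectrum_gap (B eta : R) (om : R -> R) :
  0 < eta -> (forall eps, 0 < eps -> 0 < om eps <= eps) ->
  exists2 eps0, 0 < eps0 & forall (I F : finType) (f : I -> F -> R),
    \sum_xi \sum_i f i xi ^+ 2 <= B ->
    exists2 eps, eps0 <= eps &
      \sum_(xi in spec f (om eps) :\: spec f eps) \sum_i f i xi ^+ 2 <= eta.
Proof.
move=> eta0 omP.
pose s k := iter k om 1.
have s0 k : 0 < s k by elim: k => //= k /omP/andP[].
have sS k : s k.+1 <= s k by have /andP[] := omP _ (s0 k).
have sle k l : (k <= l)%N -> s l <= s k.
  elim: l => [|l IH]; first by rewrite leqn0 => /eqP ->.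
  rewrite leq_eqVlt => /orP[/eqP -> //|kl].
  by apply: le_trans (sS _) (IH _).
pose N := (Num.truncn (B / eta)).+1.
exists (s N) => // I F f fB.
pose E xi := \sum_i f i xi ^+ 2.
have E0 xi : 0 <= E xi by apply: sumr_ge0 => *; exact: sqr_ge0.
have [||k kN Hk] := @slow_increment (fun k => \sum_(xi in spec f (s k)) E xi) B eta N.
- move=> k; rewrite sumr_ge0 //=; apply: le_trans fB.
  rewrite [leRHS](bigID (mem (spec f (s k)))) /= lerDl.
  by apply: sumr_ge0 => xi _; exact: E0.
- by rewrite -ltr_pdivrMr // truncnS_gt.
exists (s k); first by rewrite sle // ltnW.
apply: le_trans Hk; rewrite lerBrDr.
have sub : spec f (s k) \subset spec f (s k.+1).
  apply/subsetP => xi; rewrite !inE => /existsP[i fi]; apply/existsP; exists i.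
  exact: le_lt_trans (sS k) fi.
rewrite [leRHS](bigID (mem (spec f (s k)))) /= addrC lerD //.
  rewrite le_eqVlt; apply/orP; left; apply/eqP; apply: eq_bigl => xi.
  by rewrite in_setD andbC.
rewrite le_eqVlt; apply/orP; left; apply/eqP; apply: eq_bigl => xi.
by have [/(subsetP sub) ->|] := boolP (xi \in spec f (s k)); rewrite ?andbF.
Qed.

End SpectrumGap.

(** * Weyl bounds uniform over bounded degree *)

Section WeylUniform.
Variable R : realType.

Lemma weyl_sum_le D (eps : R) : 0 < eps ->
  exists N : nat, forall (F : finFieldType) (e : F -> R[i]) (Q : {poly F}),
    add_char e -> (forall n, (0 < n <= D)%N -> n%:R != 0 :> F) ->
    (N <= #|F|)%N -> (1 < size Q <= D.+1)%N ->
    normc (avg (fun x => e Q.[x])) <= eps.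
Proof.
move=> eps0; elim: D => [|D [N HN]].
  by exists 0%N => F e Q _ _ _; case: (size Q) => [|[]].
have [N' HN'] := weyl_sum D eps0.
exists (maxn N N') => F e Q eC chF; rewrite geq_max => /andP[NF NF'].
case/andP=> sQ; rewrite leq_eqVlt => /orP[/eqP sQ'|sQ']; first exact: HN'.
apply: HN => //; last by rewrite sQ.
by move=> n /andP[n0 nD]; apply: chF; rewrite n0 leqW.
Qed.

(** A nonzero tuple gives a nonconstant polynomial of degree at most [K]. *)
Lemma weyl_powers K (eps : R) : 0 < eps ->
  exists N : nat, forall (F : finFieldType) (e : F -> R[i]),
    add_char e -> (forall n, (0 < n <= K)%N -> n%:R != 0 :> F) ->
    (N <= #|F|)%N -> forall xi : {ffun 'I_K -> F}, xi != 0 ->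
    normc (avg (fun x => e (\sum_k xi k * x ^+ k.+1))) <= eps.
Proof.
move=> /(weyl_sum_le K)[N HN]; exists N => F e eC chF NF xi xi0.
pose Q : {poly F} := \sum_k xi k *: 'X^(k.+1).
rewrite (eq_avg (g := fun x => e Q.[x])) => [|x]; last first.
  rewrite horner_sum; congr (e _); apply: eq_bigr => k _.
  by rewrite hornerZ hornerXn.
apply: HN => //; apply/andP; split; last first.
  apply: leq_trans (size_sum _ _ _) _; apply/bigmax_leqP => k _.
  by apply: leq_trans (size_scale_leq _ _) _; rewrite size_polyXn ltnS.
have [k xik] : exists k, xi k != 0.
  apply/existsP; apply: contraR xi0; rewrite negb_exists => /forallP H.
  by apply/eqP/ffunP => k; rewrite ffunE; apply/eqP; move: (H k); rewrite negbK.
rewrite ltnNge; apply/negP => /leq_sizeP /(_ k.+1 isT) /eqP.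
rewrite coef_sum (bigD1 k) //= big1 ?addr0 => [|l lk].
  by rewrite coefZ coefXn eqxx mulr1 (negPf xik).
rewrite coefZ coefXn eqSS.
have -> : ((k : nat) == l) = false by rewrite -[LHS]/(k == l) eq_sym (negPf lk).
by rewrite mulr0.
Qed.

End WeylUniform.

Lemma card_sets_ord r : #|{set 'I_r}| = (2 ^ r)%N.
Proof. by rewrite -cardsT -powersetT card_powerset cardsT card_ord. Qed.

(** * Dense colours *)

Section Colouring.
Variables (R : realType) (K r : nat).

(** Chosen so that [r] times it is at most 4^-r / 4; [r.+1] keeps it positive when [r = 0]. *)
Definition threshold : R := (4 ^+ r * 4 * r.+1%:R)^-1.

Lemma threshold_gt0 : 0 < threshold.
Proof. by rewrite invr_gt0 !mulr_gt0 ?exprn_gt0. Qed.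

Lemma threshold_le1 : threshold <= 1.
Proof.
rewrite invf_le1 ?mulr_gt0 ?exprn_gt0 // !mulr_ege1 ?exprn_ege1 ?ler1n //;
  by rewrite (_ : 1 = 1%:R) // ler_nat.
Qed.

(** Writes a single value as a product over all exponents, the shape that [equidistribution]
    handles. *)
Lemma prodX_pick (T : comNzRingType) (g : nat -> T) b : (0 < b <= K)%N ->
  \prod_(k < K) g k.+1 ^+ (k.+1 == b) = g b.
Proof.
case: b => // b /= bK; rewrite (bigD1 (Ordinal bK)) //= eqxx expr1.
rewrite big1 ?mulr1 // => k kb; rewrite eqSS.
by have -> : ((k : nat) == b) = false by apply: negbTE; exact: kb.
Qed.

Variables (F : finFieldType).
Implicit Types A : {set F}.

Definition weight A (x : F) : R := \prod_(k < K) ker R A (x ^+ k.+1).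

Variable c : F -> 'I_r.

Definition part A i (x : F) : R := (c x == i)%:R * weight A x.

Definition dense_colours A : {set 'I_r} :=
  [set i | threshold <= avg (part A i)].

Lemma weight_ge0 A x : 0 <= weight A x.
Proof. by apply: prodr_ge0 => k _; exact: ker_ge0. Qed.

Lemma part_ge0 A i x : 0 <= part A i x.
Proof. by rewrite mulr_ge0 ?weight_ge0. Qed.

Lemma weight_le A (M : R) x : #|F|%:R <= M * #|A|%:R -> weight A x <= M ^+ K.
Proof.
move=> AM; rewrite -[X in _ <= _ ^+ X](card_ord K) -prodr_const; apply: ler_prod => k _.
by rewrite ker_ge0 (ker_le AM).
Qed.

Lemma part_le A (M : R) i x : #|F|%:R <= M * #|A|%:R ->
  part A i x <= M ^+ K * (c x == i)%:R.
Proof.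
move=> AM; rewrite /part mulrC ler_wpM2r //; exact: weight_le.
Qed.

Lemma sum_part A x : \sum_i part A i x = weight A x.
Proof.
rewrite -mulr_suml (bigD1 (c x)) //= eqxx big1 ?addr0 ?mul1r // => i.
by rewrite eq_sym => /negPf ->.
Qed.

Lemma weight_supp A x a : (0 < a <= K)%N -> weight A x != 0 -> ker R A (x ^+ a) != 0.
Proof.
case: a => // a /= aK; apply: contraNneq => ka.
by rewrite /weight (bigD1 (Ordinal aK)) //= ka mul0r.
Qed.

(** The distribution of [y ^+ b] under [f], seen at the scale of [A']: the normalised mass falling
    in the translate [A' - t]. *)
Definition smooth A' (f : F -> R) (b : nat) (t : F) : R :=
  avg (fun y => f y * dens R A' (t + y ^+ b)).

Lemma smooth_ge0 A' f b t : (forall x, 0 <= f x) -> 0 <= smooth A' f b t.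
Proof. by move=> f0; apply: avg_ge0 => x; rewrite mulr_ge0 ?dens_ge0. Qed.

Section PopularColour.
Variables (e : F -> R[i]) (A A' : {set F}) (M M' eps : R) (b g : nat).
Hypothesis e_char : add_char e.
Hypothesis AM : #|F|%:R <= M * #|A|%:R.
Hypothesis AM' : #|F|%:R <= M' * #|A'|%:R.
Hypothesis bK : (0 < b <= K)%N.
Hypothesis gK : (0 < g <= K)%N.
Hypothesis eps0 : 0 <= eps.
Hypothesis weyl : forall xi : {ffun 'I_K -> F}, xi != 0 ->
  normc (avg (fun x => e (\sum_k xi k * x ^+ k.+1))) <= eps.

(** The dual of [smooth], see [smooth_exchange]. Being a correlation, it has a bounded Wiener
    norm. *)
Definition ssmooth (P : {set F}) (u : F) : R :=
  avg (fun t => (t \in P)%:R * dens R A' (t + u)).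

Lemma ssmooth_ge0 P u : 0 <= ssmooth P u.
Proof. by apply: avg_ge0 => x; rewrite mulr_ge0 ?dens_ge0. Qed.

Lemma ssmooth_le1 P u : ssmooth P u <= 1.
Proof.
rewrite -(avg_dens AM') -[leRHS](avg_shift u); apply: ler_avg => t.
by case: (t \in P); rewrite ?mul1r // mul0r dens_ge0.
Qed.

Lemma wiener_ssmooth P : wiener e (ssmooth P) <= M'.
Proof.
have h1 : \sum_xi normc (fourier e (fun t => (t \in P)%:R) id xi) ^+ 2 <= 1.
  rewrite -[leRHS]mul1r -[X in _ * X](expr1n _ 2) -[X in X * _]/(1%:R).
  apply: (parseval_le e_char) => [x|t]; first by case: (x \in P); rewrite ?lexx ?ler01.
  by rewrite (_ : [set x | x == t] = [set t]) ?cards1 //; apply/setP => x; rewrite !inE.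
apply: le_trans (wiener_corr e_char h1 (sum_dens2 e_char AM')) _.
have := dense_ge1 AM'; lra.
Qed.

(** Under [weight A] the powers of [x] behave like independent variables of density [ker R A]; the
    subtracted term is the equidistribution error. *)
Lemma pair_mass P :
  avg (fun u => ker R A u * ssmooth P u) ^+ 2 - eps * (M * M' ^+ 2) ^+ K <=
  avg (fun x => weight A x * (ssmooth P (x ^+ b) * ssmooth P (x ^+ g))).
Proof.
set m := avg _; have M1 := dense_ge1 AM; have M1' := dense_ge1 AM'.
(* The multiplicity of [k] among [b] and [g]. It is 2 when they coincide, and [avg_sqr] then treats
   the square. *)
pose n k := ((k == b) + (k == g))%N.
pose f (k : 'I_K) x := ker R A x * ssmooth P x ^+ n k.+1.
have nk k : (n k <= 2)%N by rewrite /n; do 2 case: eqP.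
have := equidistribution e_char f eps0 weyl.
rewrite (eq_avg (g := fun x => weight A x * (ssmooth P (x ^+ b) * ssmooth P (x ^+ g)))); last first.
  move=> x; rewrite big_split /=; congr (_ * _).
  rewrite /n; under eq_bigr do rewrite exprD.
  by rewrite big_split /= (prodX_pick (fun k => ssmooth P (x ^+ k)) bK)
    (prodX_pick (fun k => ssmooth P (x ^+ k)) gK).
have m0 : 0 <= m by apply: avg_ge0 => u; rewrite mulr_ge0 ?ker_ge0 ?ssmooth_ge0.
have h1 : m ^+ 2 <= \prod_k avg (f k).
  rewrite (_ : m ^+ 2 = \prod_(k < K) m ^+ n k.+1).
    apply: ler_prod => k _; rewrite exprn_ge0 //= /f.
    case: (n _) (nk k.+1) => [|[|[|//]]] _.
    - by rewrite expr0 (eq_avg (g := ker R A)) ?(avg_ker AM) // => u; rewrite expr0 mulr1.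
    - by rewrite expr1 le_eqVlt; apply/orP; left; apply/eqP; apply: eq_avg => u; rewrite expr1.
    - by apply: avg_sqr; [exact: ker_ge0 | exact: (avg_ker AM)].
  rewrite /n; under eq_bigr do rewrite exprD.
  by rewrite big_split /= (prodX_pick (fun=> m) bK) (prodX_pick (fun=> m) gK).
have h2 : \prod_k wiener e (f k) <= (M * M' ^+ 2) ^+ K.
  rewrite -[X in _ <= _ ^+ X](card_ord K) -prodr_const; apply: ler_prod => k _.
  rewrite wiener_ge0 /=; apply: le_trans (wienerM e_char _ _) _.
  apply: ler_pM; rewrite ?wiener_ge0 //; first exact: wiener_ker.
  apply: le_trans (wienerX e_char _ _) _.
  apply: (@le_trans _ _ (M' ^+ n k.+1)).
    by apply: lerXn2r; rewrite ?nnegrE ?wiener_ge0 ?wiener_ssmooth ?(le_trans ler01 M1').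
  by rewrite ler_weXn2l.
have h3 := ler_wpM2l eps0 h2.
rewrite ler_distl => /andP[h4 _]; lra.
Qed.

Lemma smooth_exchange P f k :
  avg (fun x => f x * ssmooth P (x ^+ k)) =
  avg (fun t => (t \in P)%:R * smooth A' f k t).
Proof.
rewrite /ssmooth /smooth.
rewrite (eq_avg (g := fun x => avg (fun t => (t \in P)%:R * (f x * dens R A' (t + x ^+ k))))).
  by rewrite exchange_avg; apply: eq_avg => t; rewrite avgZ.
by move=> x; rewrite -avgZ; apply: eq_avg => t; rewrite mulrCA.
Qed.

(* Split F according to which colours have a large smoothed b-th power density.
   On the product of the heaviest cell with itself every colour carries little
   mass, unless its smoothed b-th and g-th power densities overlap. *)
Lemma popular_colour : eps * (M * M' ^+ 2) ^+ K <= (4 ^+ r)^-1 / 4 ->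
  exists2 i, i \in dense_colours A &
    threshold ^+ 2 <=
      avg (fun t => smooth A' (part A i) b t * smooth A' (part A i) g t).
Proof.
move=> epsK; set d := threshold; have d0 : 0 < d by exact: threshold_gt0.
pose G i t := smooth A' (part A i) b t.
pose H i t := smooth A' (part A i) g t.
have G0 i t : 0 <= G i t by apply: smooth_ge0 => x; exact: part_ge0.
have H0 i t : 0 <= H i t by apply: smooth_ge0 => x; exact: part_ge0.
pose U t : {set 'I_r} := [set i | d <= G i t].
pose P (S : {set 'I_r}) : {set F} := [set t | U t == S].
pose m S := avg (fun u => ker R A u * ssmooth (P S) u).
have summ : \sum_S m S = 1.
  rewrite -avg_sum -(avg_ker AM); apply: eq_avg => u; rewrite -mulr_sumr.
  rewrite -avg_sum -[RHS]mulr1; congr (_ * _).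
  transitivity (avg (dens R A')); last exact: (avg_dens AM').
  rewrite -[RHS](avg_shift u); apply: eq_avg => t.
  rewrite -mulr_suml (bigD1 (U t)) //= inE eqxx big1 ?addr0 ?mul1r // => S.
  by rewrite inE eq_sym => /negPf ->.
have m0 S : 0 <= m S by apply: avg_ge0 => u; rewrite mulr_ge0 ?ker_ge0 ?ssmooth_ge0.
(* The 2^r cells [P S] have total mass 1. *)
have [S mS] : exists S, (2 ^+ r)^-1 <= m S.
  apply/existsP; apply: contraT; rewrite negb_exists => /forallP no.
  have : \sum_S m S < \sum_(S : {set 'I_r}) (2 ^+ r)^-1.
    apply: ltr_sum => [|S _]; last by rewrite ltNge no.
    by apply/hasP; exists set0; rewrite ?mem_index_enum.
  rewrite summ sumr_const card_sets_ord -[X in _ < X]mulr_natr natrX mulVf ?ltxx //.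
  by rewrite expf_neq0 ?pnatr_eq0.
have mS2 : (4 ^+ r)^-1 <= m S ^+ 2.
  rewrite (_ : (4 ^+ r)^-1 = (2 ^+ r)^-1 ^+ 2).
    by rewrite ler_pXn2r ?nnegrE ?invr_ge0 ?exprn_ge0.
  by rewrite exprVn -exprM mulnC exprM expr2 -natrM.
have low := pair_mass (P S); rewrite -/(m S) in low.
have [/existsP[i /andP[iD iG]]|no] :=
  boolP [exists i, (i \in dense_colours A) && (d ^+ 2 <= avg (fun t => G i t * H i t))].
  by exists i.
(* If no colour works, [up] contradicts [low], whose left side is at least three quarters of
   4^-r. *)
suff up : avg (fun x => weight A x * (ssmooth (P S) (x ^+ b) * ssmooth (P S) (x ^+ g)))
   <= r%:R * d.
  have : r%:R * d <= (4 ^+ r)^-1 / 4.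
    rewrite /d /threshold !invfM mulrCA ler_piMr ?mulr_ge0 ?invr_ge0 ?exprn_ge0 //.
    by rewrite ler_pdivrMr ?ltr0n // mul1r ler_nat leqnSn.
  have : 0 < (4 ^+ r)^-1 :> R by rewrite invr_gt0 exprn_gt0.
  lra.
rewrite (eq_avg (g := fun x => \sum_i part A i x *
    (ssmooth (P S) (x ^+ b) * ssmooth (P S) (x ^+ g)))); last first.
  by move=> x; rewrite -mulr_suml sum_part.
rewrite avg_sum mulr_natl -[X in _ <= _ *+ X](card_ord r) -sumr_const; apply: ler_sum => i _.
move: no; rewrite negb_exists => /forallP /(_ i); rewrite negb_and inE -ltNge -ltNge.
have s1 k x : 0 <= ssmooth (P S) (x ^+ k) <= 1 by rewrite ssmooth_ge0 ssmooth_le1.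
case/orP => [small|small].
  apply: le_trans (ltW small); apply: ler_avg => x.
  rewrite -[leRHS]mulr1 ler_wpM2l ?part_ge0 // -[leRHS]mulr1.
  by have /andP[? ?] := s1 b x; have /andP[? ?] := s1 g x; rewrite ler_pM.
(* On [P S] a colour outside [S] has [G] below [d]. A colour in [S] has [G] at least [d], so there
   [d] times [H] is at most the overlap [G * H], whose average is below [d ^+ 2]. *)
have [iS|iS] := boolP (i \in S); last first.
  apply: (@le_trans _ _ (avg (fun x => part A i x * ssmooth (P S) (x ^+ b)))).
    apply: ler_avg => x; rewrite ler_wpM2l ?part_ge0 //.
    by have /andP[? ?] := s1 b x; have /andP[? ?] := s1 g x; rewrite ler_piMr.
  rewrite smooth_exchange -[leRHS](avg_cst F); apply: ler_avg => t.
  rewrite inE; case: eqP => [US|_]; last by rewrite mul0r ltW.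
  by move: iS; rewrite -US inE -ltNge mul1r => /ltW.
apply: (@le_trans _ _ (avg (fun x => part A i x * ssmooth (P S) (x ^+ g)))).
  apply: ler_avg => x; rewrite ler_wpM2l ?part_ge0 //.
  by have /andP[? ?] := s1 b x; have /andP[? ?] := s1 g x; rewrite ler_piMl.
rewrite smooth_exchange -(ler_pM2l d0) -avgZ -expr2.
apply: le_trans (ltW small); apply: ler_avg => t.
rewrite inE; case: eqP => [US|_]; last by rewrite mul0r mulr0 mulr_ge0.
by move: iS; rewrite -US inE mul1r => h; rewrite ler_wpM2r ?H0.
Qed.

End PopularColour.

End Colouring.

(** * Trilinear counts as overlaps of smoothed densities *)

Section Counting.
Variables (R : realType) (F : finFieldType).
Implicit Types (a b w : F -> R) (u v h : F -> F).

Lemma trilin_ker a u b v w :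
  trilin a u b v w id = avg (fun x => avg (fun y => a x * b y * w (- (u x + v y)))).
Proof.
rewrite /trilin expr2 invfM mulrA /avg -mulr_suml; congr (_ / _ / _).
apply: eq_bigr => x _; apply: eq_bigr => y _.
rewrite (bigD1 (- (u x + v y))) //= subrr eqxx mul1r big1 ?addr0 // => z zuv.
rewrite addrC addr_eq0; move: zuv => /negPf ->; exact: mul0r.
Qed.

(** Translating the variable of the autocorrelation by [y ^+ be] gives [y] and [z] a factor [dens]
    each. *)
Lemma trilin_smooth (A : {set F}) a b (be ga : nat) :
  trilin a (fun y => y ^+ be) b (fun z => - z ^+ ga) (ker R A) id =
  avg (fun t => smooth A a be t * smooth A b ga t).
Proof.
rewrite trilin_ker /smooth.
under [RHS]eq_avg => t do rewrite avg_mulr.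
rewrite [RHS]exchange_avg; apply: eq_avg => y.
rewrite [RHS]exchange_avg; apply: eq_avg => z.
rewrite /ker -avgZ -[LHS](avg_shift (y ^+ be)); apply: eq_avg => t.
rewrite mulrACA; congr (_ * (_ * dens R A _)).
by rewrite opprB addrACA subrr addr0.
Qed.

Lemma ler_trilin a a' u b b' v w w' h :
  (forall x, 0 <= a x <= a' x) -> (forall x, 0 <= b x <= b' x) ->
  (forall x, 0 <= w x <= w' x) -> trilin a u b v w h <= trilin a' u b' v w' h.
Proof.
move=> ha hb hw; rewrite /trilin ler_wpM2r ?invr_ge0 ?exprn_ge0 //.
apply: ler_sum => x _; apply: ler_sum => y _; apply: ler_sum => z _.
have /andP[a0 aa] := ha x; have /andP[b0 bb] := hb y; have /andP[w0 ww] := hw z.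
by rewrite ler_wpM2l // ler_pM ?mulr_ge0 // ler_pM.
Qed.

Lemma trilinZ (k1 k2 k3 : R) a u b v w h :
  trilin (fun x => k1 * a x) u (fun x => k2 * b x) v (fun x => k3 * w x) h =
  k1 * k2 * k3 * trilin a u b v w h.
Proof.
rewrite /trilin mulrA; congr (_ / _); rewrite mulr_sumr; apply: eq_bigr => x _.
rewrite mulr_sumr; apply: eq_bigr => y _.
rewrite mulr_sumr; apply: eq_bigr => z _; ring.
Qed.

Lemma card_roots n (t : F) : (0 < n)%N -> (#|[set x : F | x ^+ n == t]| <= n)%N.
Proof.
move=> n0; have sP : size ('X^n - t%:P : {poly F}) = n.+1 by rewrite size_XnsubC.
have P0 : 'X^n - t%:P != 0 :> {poly F} by rewrite -size_poly_eq0 sP.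
rewrite cardE -ltnS -sP; apply: max_poly_roots => //; last exact: enum_uniq.
by apply/allP => x; rewrite mem_enum inE rootE !hornerE subr_eq0.
Qed.

End Counting.

(** * Refining a family of dense sets *)

Section Refinement.
Variables (R : realType) (K r al be ga : nat).
Hypothesis alK : (0 < al <= K)%N.
Hypothesis beK : (0 < be <= K)%N.
Hypothesis gaK : (0 < ga <= K)%N.

(** The variable [x] comes last because it is the one weighted by the refined set. *)
Definition mono_density (F : finFieldType) (c : F -> 'I_r) (i : 'I_r) : R :=
  trilin (fun x => (c x == i)%:R) (fun y => y ^+ be)
         (fun x => (c x == i)%:R) (fun z => - z ^+ ga)
         (fun x => (c x == i)%:R) (fun x => x ^+ al).

Lemma sum_fourier_part (F : finFieldType) (e : F -> R[i]) (c : F -> 'I_r)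
    (A : {set F}) (M : R) i u :
  add_char e -> #|F|%:R <= M * #|A|%:R ->
  (forall t, (#|[set x | u x == t]| <= K)%N) ->
  \sum_xi normc (fourier e (part R K c A i) u xi) ^+ 2 <= K%:R * (M ^+ K) ^+ 2.
Proof.
move=> eC AM uK; apply: (parseval_le eC) => // x; rewrite part_ge0 /=.
apply: le_trans (part_le _ _ _ _ AM) _.
have M0 : 0 <= M := le_trans ler01 (dense_ge1 AM).
by rewrite ler_piMr ?exprn_ge0 // lern1; case: (_ == _).
Qed.

Lemma card_powers (F : finFieldType) b : (0 < b <= K)%N ->
  forall t : F, (#|[set x : F | x ^+ b == t]| <= K)%N.
Proof. by case/andP=> b0 bK t; apply: leq_trans (card_roots _ b0) bK. Qed.

Lemma card_oppr_powers (F : finFieldType) b : (0 < b <= K)%N ->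
  forall t : F, (#|[set x : F | - x ^+ b == t]| <= K)%N.
Proof.
move=> bK t; rewrite (_ : [set x | _] = [set x | x ^+ b == - t]) ?card_powers //.
by apply/setP => x; rewrite !inE eqr_oppLR.
Qed.

(** One [A'] must serve every [A] in [s], so the spectra of all colours on all these sets share one
    scale. The popular colour of [A] has a large overlap smoothed at [A'], and [trilin_compare]
    turns it into solutions in proportion to the mass of that colour on [A']. *)
Lemma refinement_step (M : R) (n : nat) : 1 <= M ->
  exists M' : R, exists k : R, exists N : nat, [/\ 1 <= M', 0 < k &
    forall (F : finFieldType) (e : F -> R[i]) (c : F -> 'I_r) (s : seq {set F}),
      add_char e -> (forall m, (0 < m <= K)%N -> m%:R != 0 :> F) ->
      (N <= #|F|)%N -> size s = n ->
      (forall A, A \in s -> #|F|%:R <= M * #|A|%:R) ->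
      exists2 A' : {set F}, #|F|%:R <= M' * #|A'|%:R &
        forall A, A \in s -> exists2 i, i \in dense_colours R K c A &
          (i \in dense_colours R K c A' -> k <= mono_density c i)].
Proof.
move=> M1; have M0 : 0 < M by apply: lt_le_trans M1.
set d := threshold R r; have d0 : 0 < d := threshold_gt0 R r.
have d1 : d <= 1 := threshold_le1 R r.
pose kap := d ^+ 2; have kap0 : 0 < kap by rewrite exprn_gt0.
have K0 : (0 < K)%N by case/andP: alK => h1 h2; apply: leq_trans h2.
have KR : 0 < K%:R :> R by rewrite ltr0n.
(* [B] bounds the energy of one spectrum, [Bt] that of all of them: one per set, colour and power
   map. The size of [n0] makes the phase error 2 / n0 times [B] at most kap / 16. *)
pose B : R := K%:R * (M ^+ K) ^+ 2.
have B0 : 0 < B by rewrite mulr_gt0 ?exprn_gt0.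
pose Bt : R := (n * r * 2)%:R * B.
pose n0 := (Num.truncn (32 * B / kap)).+1.
pose m : R := (n0.*2.+1 ^ 2)%:R.
have m1 : 1 <= m by rewrite ler1n expn_gt0.
(* Inverse density of a cell for the at most Bt / eps^2 frequencies above [eps], at a cost of [m]
   each. *)
pose Mf (eps : R) : R := m ^+ (Num.truncn (Bt / eps ^+ 2)).
have Mf1 eps : 1 <= Mf eps by rewrite exprn_ege1.
pose Bw (eps : R) : R := K%:R * (Mf eps ^+ K) ^+ 2 + Mf eps.
have Bw0 eps : 0 < Bw eps.
  have h : 0 < Mf eps by apply: lt_le_trans (Mf1 eps).
  by rewrite addr_gt0 // mulr_gt0 ?exprn_gt0.
(* Frequencies below [om eps] must be negligible against the energy [Bw eps] of weights living on
   the cell, and that energy grows as [eps] shrinks; hence the need for [spectrum_gap]. *)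
pose om (eps : R) : R := Num.min eps (d * kap / 8 / (B + Bw eps)).
have omP eps : 0 < eps -> 0 < om eps <= eps.
  move=> eps0; rewrite /om lt_min eps0 ge_min lexx /= andbT.
  by rewrite divr_gt0 ?(divr_gt0 (mulr_gt0 d0 kap0)) // (addr_gt0 B0 (Bw0 _)).
have eta0 : 0 < kap / 16 by rewrite divr_gt0.
have [eps0 eps00 gap] := spectrum_gap Bt eta0 omP.
pose M' := Mf eps0; have M'1 : 1 <= M' := Mf1 eps0.
have M'0 : 0 < M' by apply: lt_le_trans M'1.
pose th : R := (4 ^+ r)^-1 / 4.
have th0 : 0 < th by rewrite divr_gt0 ?invr_gt0 ?exprn_gt0.
pose ew := th / (M * M' ^+ 2) ^+ K.
have MM0 : 0 < (M * M' ^+ 2) ^+ K by rewrite exprn_gt0 ?mulr_gt0 ?exprn_gt0.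
have ew0 : 0 < ew by rewrite divr_gt0.
have [N weyl] := weyl_powers K ew0.
(* The cost of replacing the three weighted colour classes by indicators. *)
pose kk := M ^+ K * M ^+ K * M' ^+ K.
have kk0 : 0 < kk by rewrite !mulr_gt0 ?exprn_gt0.
exists M', (d * kap / 2 / kk), N; split=> //.
  by rewrite divr_gt0 ?(divr_gt0 (mulr_gt0 d0 kap0)).
move=> F e c s eC chF NF sn sM.
pose u : F -> F := fun y => y ^+ be.
pose v : F -> F := fun z => - z ^+ ga.
pose f (j : 'I_n * 'I_r * bool) (xi : F) : R :=
  normc (fourier e (part R K c (nth set0 s j.1.1) j.1.2) (if j.2 then u else v) xi).
have sA (j : 'I_n) : #|F|%:R <= M * #|nth set0 s j|%:R :> R.
  by apply: sM; rewrite mem_nth // sn.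
have uK t : (#|[set x | u x == t]| <= K)%N by exact: card_powers.
have vK t : (#|[set x | v x == t]| <= K)%N by exact: card_oppr_powers.
have fB : \sum_xi \sum_j f j xi ^+ 2 <= Bt.
  rewrite exchange_big /Bt mulr_natl.
  have -> : (n * r * 2 = #|{: 'I_n * 'I_r * bool}|)%N.
    by rewrite !card_prod !card_ord card_bool.
  rewrite -sumr_const; apply: ler_sum => j _.
  by apply: sum_fourier_part => //; case: j.2.
have [eps eps_ge mid] := gap _ _ _ fB.
have epsg : 0 < eps by apply: lt_le_trans eps_ge.
set L := spec f eps in mid; set S := spec f (om eps) in mid.
have [A' cA' HA'] := bohr_cell (enum L) eC (ltn0Sn _ : (0 < n0)%N).
have sL : #|L|%:R <= Bt / eps ^+ 2 by exact: card_spec.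
have A'f : #|F|%:R <= Mf eps * #|A'|%:R :> R.
  apply: (@le_trans _ _ (m ^+ #|L| * #|A'|%:R)).
    rewrite mulrC /m -natrX -natrM ler_nat; apply: leq_trans cA' _.
    by rewrite -cardE.
  rewrite ler_wpM2r // ler_weXn2l // truncn_ge_nat //.
  by apply: le_trans sL.
(* The scale found is at least [eps0], so the bound at [eps0] covers every case. *)
have Mff : Mf eps <= M'.
  rewrite ler_weXn2l // le_truncn //.
  rewrite ler_wpM2l ?(mulr_ge0 _ (ltW B0)) //.
  rewrite lef_pV2 ?posrE ?exprn_gt0 // ler_pXn2r ?nnegrE //; exact: ltW.
have A'M : #|F|%:R <= M' * #|A'|%:R :> R.
  by apply: le_trans A'f _; rewrite ler_wpM2r.
exists A' => // A As.
have AM := sM _ As.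
have epsK : ew * (M * M' ^+ 2) ^+ K <= th by rewrite divfK // lt0r_neq0.
have [i iD low] :=
  popular_colour c eC AM A'M beK gaK (ltW ew0) (weyl F e eC chF NF) epsK.
exists i => // iD'.
pose w := part R K c A' i.
have w0 x : 0 <= w x by exact: part_ge0.
rewrite ler_pdivrMr //.
apply: (@le_trans _ _ (trilin (part R K c A i) u (part R K c A i) v w (fun x => x ^+ al))); last first.
  apply: le_trans (_ : _ <= trilin (fun x => M ^+ K * (c x == i)%:R) u
     (fun x => M ^+ K * (c x == i)%:R) v (fun x => M' ^+ K * (c x == i)%:R) (fun x => x ^+ al)) _.
    by apply: ler_trilin => x; rewrite part_ge0 part_le.
  by rewrite trilinZ mulrC.
(* The position of [A] in [s], with [index A s < size s] transported along [sn]. *)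
pose j : 'I_n := Ordinal (eq_ind _ (fun k => index A s < k)%N (etrans (index_mem A s) As) _ sn).
have aB : \sum_xi normc (fourier e (part R K c A i) u xi) ^+ 2 <= B by exact: sum_fourier_part.
have bB : \sum_xi normc (fourier e (part R K c A i) v xi) ^+ 2 <= B by exact: sum_fourier_part.
have MfM : 0 <= Mf eps by apply: le_trans (Mf1 eps).
have wB : \sum_xi normc (fourier e w (fun x => x ^+ al) xi) ^+ 2 <= Bw eps.
  apply: le_trans (sum_fourier_part _ _ eC A'f _) _; first exact: card_powers.
  by rewrite lerDl.
have kB : \sum_xi normc (fourier e (ker R A') id xi) ^+ 2 <= Bw eps.
  apply: (@le_trans _ _ (Mf eps)); last first.
    by rewrite lerDr ltW // mulr_gt0 ?exprn_gt0 // (lt_le_trans ltr01).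
  apply: le_trans (wiener_ker eC A'f); apply: ler_sum => xi _.
  (* Coefficients are at most the mean 1 of the kernel, so their squares are bounded by the Wiener
     norm. *)
  rewrite expr2 ler_piMr ?normc_ge0 // -(avg_ker A'f).
  by apply: normc_fourier => // x; exact: ker_ge0.
have mid' : \sum_(xi in S :\: L) (normc (fourier e (part R K c A i) u xi) ^+ 2 +
     normc (fourier e (part R K c A i) v xi) ^+ 2) <= kap / 16.
  apply: le_trans mid; apply: ler_sum => xi _.
  have jj : (j, i, false) != (j, i, true) by rewrite xpair_eqE andbF.
  rewrite (bigD1 (j, i, true)) //= (bigD1 (j, i, false) jj) /= /f /= nth_index //.
  by rewrite addrA lerDl sumr_ge0 // => *; exact: sqr_ge0.
have far xi : xi \notin S -> normc (fourier e (part R K c A i) u xi) <= om eps.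
  rewrite inE negb_exists => /forallP /(_ (j, i, true)).
  by rewrite -leNgt /f /= nth_index.
have kL x xi : xi \in L -> ker R A' x != 0 -> normc (e (xi * x) - 1) <= 2 / n0%:R.
  by move=> xiL /ker_supp [y [z [yA zA ->]]]; apply: HA' => //; rewrite mem_enum.
have wL x xi : xi \in L -> w x != 0 -> normc (e (xi * x ^+ al) - 1) <= 2 / n0%:R.
  move=> xiL; rewrite mulf_eq0 negb_or => /andP[_ /weight_supp].
  by move=> /(_ _ alK); apply: kL.
have /andP[om0 _] := omP _ epsg.
have rho0 : 0 <= 2 / n0%:R :> R by rewrite divr_ge0.
have := trilin_compare eC w0 wL (@ker_ge0 R F A') (avg_ker A'f) kL aB bB wB kB mid' far rho0 (ltW om0).
apply: le_trans.
rewrite trilin_smooth //.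
have rhoB : 2 / n0%:R * B <= kap / 16.
  have : 32 * B / kap <= n0%:R by apply: ltW; exact: truncnS_gt.
  rewrite ler_pdivrMr // => h.
  by rewrite mulrAC ler_pdivrMr ?ltr0n //; lra.
have omB : om eps * (B + Bw eps) <= d * kap / 8.
  by rewrite -ler_pdivlMr ?(addr_gt0 B0 (Bw0 _)) // /om ge_min lexx orbT.
have iw : d <= avg w by move: iD'; rewrite inE.
have kd : d * kap <= kap by rewrite ler_piMl // ltW.
(* Here 5/8 = 1 - 2 (1/16 + 1/16) - 1/8; after multiplication by the mass of [w], at least [d], the
   last error [d * kap / 8] leaves one half. *)
have X : kap * (5 / 8) <= avg (fun t => smooth A' (part R K c A i) be t * smooth A' (part R K c A i) ga t)
   - 2 * (2 / n0%:R * B + kap / 16) - om eps * (B + Bw eps).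
  by rewrite -/d -/kap in low; lra.
have := ler_pM (ltW d0) (mulr_ge0 (ltW kap0) (divr_ge0 (ler0n _ 5) (ler0n _ 8))) iw X.
lra.
Qed.

End Refinement.

(** * Iterating the refinement and counting solutions *)

Section Conclusion.
Variables (R : realType) (K r al be ga : nat).
Hypothesis alK : (0 < al <= K)%N.
Hypothesis beK : (0 < be <= K)%N.
Hypothesis gaK : (0 < ga <= K)%N.

(** If the new set has the same dense colours as an earlier [A], the colour found for [A] is dense
    on it too and yields solutions; otherwise the list grows. *)
Lemma refinement_chain (n : nat) :
  exists M : R, exists k : R, exists N : nat, [/\ 1 <= M, 0 < k &
    forall (F : finFieldType) (e : F -> R[i]) (c : F -> 'I_r),
      add_char e -> (forall m, (0 < m <= K)%N -> m%:R != 0 :> F) ->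
      (N <= #|F|)%N ->
      (exists i, k <= mono_density R al be ga c i) \/
      exists s : seq {set F}, [/\ size s = n,
        forall A, A \in s -> #|F|%:R <= M * #|A|%:R &
        uniq (map (dense_colours R K c) s)]].
Proof.
elim: n => [|n [M [k [N [M1 k0 IH]]]]].
  exists 1, 1, 0%N; split=> // F e c _ _ _; right.
  by exists [::].
have [M' [k' [N' [M'1 k'0 step]]]] := refinement_step r alK beK gaK n M1.
exists (Num.max M M'), (Num.min k k'), (maxn N N'); split.
- by rewrite le_max M1.
- by rewrite lt_min k0 k'0.
move=> F e c eC chF; rewrite geq_max => /andP[NF NF'].
have [[i ki]|[s [sn sM us]]] := IH F e c eC chF NF.
  by left; exists i; rewrite ge_min ki.
have [A' A'M HA'] := step F e c s eC chF NF' sn sM.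
have [/mapP[A As DA]|notin] :=
    boolP (dense_colours R K c A' \in map (dense_colours R K c) s).
  have [i iD low] := HA' A As; left; exists i.
  by rewrite ge_min low ?orbT // DA.
right; exists (A' :: s); split; rewrite /= ?sn ?notin // => A.
rewrite inE => /orP[/eqP ->|As].
  by apply: le_trans A'M _; rewrite ler_wpM2r // le_max lexx orbT.
by apply: le_trans (sM _ As) _; rewrite ler_wpM2r // le_max lexx.
Qed.

(** There are only 2^r sets of colours, so 2^r + 1 distinct ones cannot occur. *)
Lemma mono_density_lower :
  exists2 k : R, 0 < k & exists N : nat,
    forall (F : finFieldType) (e : F -> R[i]) (c : F -> 'I_r),
      add_char e -> (forall m, (0 < m <= K)%N -> m%:R != 0 :> F) ->
      (N <= #|F|)%N -> exists i, k <= mono_density R al be ga c i.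
Proof.
have [M [k [N [M1 k0 H]]]] := refinement_chain (2 ^ r).+1.
exists k => //; exists N => F e c eC chF NF.
have [//|[s [sn sM us]]] := H F e c eC chF NF.
have := max_card (mem (map (dense_colours R K c) s)).
by rewrite (card_uniqP us) size_map sn card_sets_ord ltnn.
Qed.

Lemma mono_density_solutions p (c : 'F_p -> 'I_r) i : prime p ->
  mono_density R al be ga c i * p%:R ^+ 2 <= #|mono_solutions al be ga c|%:R.
Proof.
move=> pp; rewrite /mono_density /trilin card_Fp //.
rewrite divfK ?expf_neq0 ?pnatr_eq0 ?gtn_eqF ?prime_gt0 //.
have -> : #|mono_solutions al be ga c|%:R =
    \sum_x \sum_y \sum_z ((x, y, z) \in mono_solutions al be ga c)%:R :> R.
  rewrite pair_bigA pair_bigA /= -sum1_card natr_sum big_mkcond /=.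
  by apply: eq_bigr => [[[x y] z]] _ /=; case: ifP.
(* [mono_density] sums in the order y, z, x, so [x] is moved innermost. *)
rewrite [leRHS]exchange_big; apply: ler_sum => y _.
rewrite [leRHS]exchange_big; apply: ler_sum => z _; apply: ler_sum => x _ /=.
rewrite inE.
have -> : (y ^+ be - z ^+ ga + x ^+ al == 0) = (x ^+ al + y ^+ be == z ^+ ga).
  by rewrite -[RHS]subr_eq0; congr (_ == 0); rewrite addrC addrA.
case: eqP => _; rewrite ?mul0r ?mul1r //.
have [cy|_] := eqVneq (c y) i; last by rewrite !mul0r.
have [cz|_] := eqVneq (c z) i; last by rewrite mulr0 mul0r.
have [cx|_] := eqVneq (c x) i; last by rewrite mulr0.
by rewrite cx cy cz eqxx !mulr1.
Qed.

End Conclusion.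

Local Close Scope complex_scope.

Theorem theorem1p2 (R : realType) (a b g r : nat)
    (ha : (0 < a)%N) (hb : (0 < b)%N) (hg : (0 < g)%N) (hr : (0 < r)%N) :
  exists2 k : R, 0 < k &
    forall (p : nat) (c : 'F_p -> 'I_r), prime p ->
      k * p%:R ^+ 2 <= #|mono_solutions a b g c|%:R.
Proof.
pose K := maxn a (maxn b g).
have aK : (0 < a <= K)%N by rewrite ha leq_maxl.
have bK : (0 < b <= K)%N by rewrite hb /K maxnCA leq_maxl.
have gK : (0 < g <= K)%N by rewrite hg /K maxnA leq_maxr.
have [k k0 [N H]] := mono_density_lower R r aK bK gK.
(* A prime [p >= N'] exceeds [K], so 1, ..., K are invertible modulo p, as Weyl differencing
   requires. For smaller [p] the triple (0, 0, 0) suffices, whence the constant 1 / N'^2. *)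
pose N' := (maxn N K).+1.
exists (Num.min k (N'%:R ^+ 2)^-1).
  by rewrite lt_min k0 invr_gt0 exprn_gt0.
move=> p c pp; have [pN|Np] := ltnP p N'.
  apply: (@le_trans _ _ 1).
    apply: (@le_trans _ _ ((N'%:R ^+ 2)^-1 * p%:R ^+ 2)).
      by rewrite ler_wpM2r ?exprn_ge0 // ge_min lexx orbT.
    rewrite ler_pdivrMl ?exprn_gt0 // mulr1 -!natrX ler_nat leq_exp2r //.
    exact: ltnW.
  rewrite ler1n; apply/card_gt0P; exists (0, 0, 0).
  by rewrite inE !expr0n !gtn_eqF // addr0 !eqxx.
have [e eC] := exists_add_char R pp.
have chF m : (0 < m <= K)%N -> m%:R != 0 :> 'F_p.
  case/andP=> m0 mK; rewrite -(dvdn_pcharf (pchar_Fp pp)) gtnNdvd //.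
  by apply: leq_ltn_trans mK _; apply: leq_trans Np; rewrite ltnS leq_maxr.
have NF : (N <= #|'F_p|)%N.
  by rewrite card_Fp // (leq_trans _ Np) // leqW // leq_maxl.
have [i ki] := H 'F_p e c eC chF NF.
apply: le_trans (mono_density_solutions R a b g c i pp).
by rewrite ler_wpM2r ?exprn_ge0 // ge_min ki.
Qed.
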